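(* Let $(V,\mu,R)$ be a braided algebra over a unital commutative ring $\mathbb{k}$. Then the second Yang-Baxter Hochschild cohomology group $H^2_{\rm YBH}(V,V)$ classifies the infinitesimal deformations of $(V,\mu,R)$: the assignment $$(\phi,\psi)\longmapsto \bigl(V\oplus\hbar V,\ \mu+\hbar\psi,\ R+\hbar\phi\bigr)$$ sends Yang-Baxter Hochschild $2$-cocycles to infinitesimal deformations, every infinitesimal deformation arises in this way from a $2$-cocycle, and two $2$-cocycles give isomorphic infinitesimal deformations if and only if they are cohomologous; hence it induces a bijection between $H^2_{\rm YBH}(V,V)$ and the set of isomorphism classes of infinitesimal deformations of $(V,\mu,R)$.
   Context: $\mathbb{k}$ is a unital commutative ring, $\otimes=\otimes_{\mathbb{k}}$, $\mathrm{Hom}=\mathrm{Hom}_{\mathbb{k}}$, and $1$ denotes the identity map of $V$. A Yang-Baxter (YB) operator on a $\mathbb{k}$-module $V$ is an invertible map $R:V\otimes V\to V\otimes V$ with $(R\otimes 1)(1\otimes R)(R\otimes 1)=(1\otimes R)(R\otimes 1)(1\otimes R)$. A braided algebra $(V,\mu,R)$ is an associative $\mathbb{k}$-algebra $(V,\mu)$ with a YB operator $R$ on $V$ satisfying (YI) $(1\otimes\mu)(R\otimes 1)(1\otimes R)=R(\mu\otimes 1)$ and (IY) $(\mu\otimes 1)(1\otimes R)(R\otimes 1)=R(1\otimes\mu)$. A homomorphism of braided algebras is an algebra homomorphism $f$ with $(f\otimes f)R_1=R_2(f\otimes f)$. The same definitions apply over other commutative rings. Infinitesimal deformations: let $\tilde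 V=V\otimes_{\mathbb{k}}\mathbb{k}[[\hbar]]/(\hbar^2)\cong V\oplus\hbar V$, and extend $\mu,R$ to $\tilde V$ $\hbar$-linearly. An infinitesimal deformation of $(V,\mu,R)$ is a braided algebra $(\tilde V,\tilde\mu,\tilde R)$ over $\mathbb{k}[[\hbar]]/(\hbar^2)$ with $\mathrm{Im}(\tilde\mu-\mu)\subset\hbar V$ and $\mathrm{Im}(\tilde R-R)\subset\hbar(V\otimes V)$; thus $\tilde\mu=\mu+\hbar\psi$, $\tilde R=R+\hbar\phi$ with $\psi:V^{\otimes 2}\to V$, $\phi:V^{\otimes 2}\to V^{\otimes 2}$. A homomorphism of infinitesimal deformations is a homomorphism of braided algebras over $\mathbb{k}[[\hbar]]/(\hbar^2)$ which is the identity of $V$ in degree $0$ (modulo $\hbar$), i.e. of the form $1+\hbar f$ with $f\in\mathrm{Hom}(V,V)$; it is an isomorphism of infinitesimal deformations if it has an inverse that is again a homomorphism of infinitesimal deformations. Cohomology: $C^1_{\rm YBH}(V,V)=\mathrm{Hom}(V,V)$, $C^2_{\rm YBH}(V,V)=\mathrm{Hom}(V^{\otimes 2},V^{\otimes 2})\oplus\mathrm{Hom}(V^{\otimes 2},V)$ (elements $\phi\oplus\psi=(\phi,\psi)$). $\delta^1_{\rm YBH}(f)=\delta^1_{\rm YB}(f)\oplus\delta^1_{\rm H}(f)$, $\delta^2_{\rm YBH}(\phi\oplus\psi)=\delta^2_{\rm YB}(\phi)\oplus\delta^2_{\rm YI}(\phi\oplus\psi)\oplus\delta^2_{\rm IY}(\phi\oplus\psi)\oplus\delta^2_{\rm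 H}(\psi)$, where $\delta^1_{\rm YB}(f)=R(f\otimes 1)+R(1\otimes f)-(f\otimes 1)R-(1\otimes f)R$; $\delta^1_{\rm H}(f)=\mu(f\otimes 1)+\mu(1\otimes f)-f\mu$; $\delta^2_{\rm YB}(\phi)=(R\otimes 1)(1\otimes R)(\phi\otimes 1)+(R\otimes 1)(1\otimes\phi)(R\otimes 1)+(\phi\otimes 1)(1\otimes R)(R\otimes 1)-(1\otimes R)(R\otimes 1)(1\otimes\phi)-(1\otimes R)(\phi\otimes 1)(1\otimes R)-(1\otimes\phi)(R\otimes 1)(1\otimes R)$; $\delta^2_{\rm H}(\psi)=\mu(\psi\otimes 1)+\psi(\mu\otimes 1)-\mu(1\otimes\psi)-\psi(1\otimes\mu)$; $\delta^2_{\rm YI}(\phi\oplus\psi)=(1\otimes\psi)(R\otimes 1)(1\otimes R)+(1\otimes\mu)(\phi\otimes 1)(1\otimes R)+(1\otimes\mu)(R\otimes 1)(1\otimes\phi)-R(\psi\otimes 1)-\phi(\mu\otimes 1)$; $\delta^2_{\rm IY}(\phi\oplus\psi)=(\psi\otimes 1)(1\otimes R)(R\otimes 1)+(\mu\otimes 1)(1\otimes\phi)(R\otimes 1)+(\mu\otimes 1)(1\otimes R)(\phi\otimes 1)-R(1\otimes\psi)-\phi(1\otimes\mu)$. Yang-Baxter Hochschild $2$-cocycles are the elements of $\ker\delta^2_{\rm YBH}$, and $H^2_{\rm YBH}(V,V)=\ker\delta^2_{\rm YBH}/\mathrm{Im}\,\delta^1_{\rm YBH}$. *)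

(* Defs.v *)
From HB Require Import structures.
From mathcomp Require Import all_boot all_algebra.
From mathcomp Require Import boolp classical_sets functions.

Set Implicit Arguments.
Unset Strict Implicit.
Unset Printing Implicit Defensive.

Import GRing.Theory.
Local Open Scope ring_scope.
Local Open Scope quotient_scope.

Notation Lin U V := {linear U%type -> V%type}.

Section HomModule.
Variables (k : comPzRingType) (U V : lmodType k).
Implicit Types f g h : Lin U V.

Lemma hom_ext f g : f =1 g -> f = g.
Proof.
case: f g => [f [[cf] [df]]] [g [[cg] [dg]]] /= /funext efg.
move: cf df cg dg; rewrite efg => cf df cg dg.
by rewrite (Prop_irrelevance cf cg) (Prop_irrelevance df dg).
Qed.

Lemma hom_congr f g x : f = g -> f x = g x. Proof. by move=> ->. Qed.

Definition mkHom (f : U -> V) (linf : linear f) : Lin U V :=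
  HB.pack f (GRing.isLinear.Build k U V *:%R f linf).

HB.instance Definition _ := gen_eqMixin (Lin U V).
HB.instance Definition _ := gen_choiceMixin (Lin U V).

Fact hom_opp_linear f : linear (fun x => - f x).
Proof. by move=> a x y; rewrite linearP opprD scalerN. Qed.

Fact hom_scale_linear (c : k) f : linear (fun x => c *: f x).
Proof. by move=> a x y; rewrite linearP scalerDr !scalerA mulrC. Qed.

Definition hom_zero : Lin U V := \0.
Definition hom_add f g : Lin U V := f \+ g.
Definition hom_opp f : Lin U V := mkHom (hom_opp_linear f).
Definition hom_scale c f : Lin U V := mkHom (hom_scale_linear c f).

Fact hom_addA : associative hom_add.
Proof. by move=> f g h; apply: hom_ext => x /=; rewrite addrA. Qed.
Fact hom_addC : commutative hom_add.
Proof. by move=> f g; apply: hom_ext => x /=; rewrite addrC. Qed.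
Fact hom_add0 : left_id hom_zero hom_add.
Proof. by move=> f; apply: hom_ext => x /=; rewrite add0r. Qed.
Fact hom_addN : left_inverse hom_zero hom_opp hom_add.
Proof. by move=> f; apply: hom_ext => x /=; rewrite addNr. Qed.

HB.instance Definition _ :=
  GRing.isZmodule.Build (Lin U V) hom_addA hom_addC hom_add0 hom_addN.

Fact hom_scaleA a b f : hom_scale a (hom_scale b f) = hom_scale (a * b) f.
Proof. by apply: hom_ext => x /=; rewrite scalerA. Qed.
Fact hom_scale1 : left_id 1 hom_scale.
Proof. by move=> f; apply: hom_ext => x /=; rewrite scale1r. Qed.
Fact hom_scaleDr : right_distributive hom_scale +%R.
Proof. by move=> a f g; apply: hom_ext => x /=; rewrite scalerDr. Qed.
Fact hom_scaleDl f : {morph hom_scale^~ f : a b / a + b}.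
Proof. by move=> a b; apply: hom_ext => x /=; rewrite scalerDl. Qed.

HB.instance Definition _ := GRing.Zmodule_isLmodule.Build k (Lin U V)
  hom_scaleA hom_scale1 hom_scaleDr hom_scaleDl.

Lemma hom0E x : (0 : Lin U V) x = 0. Proof. by []. Qed.
Lemma homDE f g x : (f + g) x = f x + g x. Proof. by []. Qed.
Lemma homNE f x : (- f) x = - f x. Proof. by []. Qed.
Lemma homBE f g x : (f - g) x = f x - g x. Proof. by []. Qed.
Lemma homZE a f x : (a *: f) x = a *: f x. Proof. by []. Qed.
End HomModule.

Definition homE := (hom0E, homDE, homNE, homBE, homZE).

Definition hcomp (k : comPzRingType) (U V W : lmodType k)
  (f : Lin V W) (g : Lin U V) : Lin U W := f \o g.
Definition hid (k : comPzRingType) (U : lmodType k) : Lin U U := idfun.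
Arguments hid {k U}.

Notation "f ∘ g" := (hcomp f g) (at level 40, left associativity).

Section QuotientModule.
Variables (k : comPzRingType) (M : lmodType k) (S : submodClosed M).

(* [submodClosed] does not inherit from [zmodClosed], which [Quotient.quot]
   requires. *)
Definition quotmod_pred : {pred M} := fun x => x \in S.

Fact quotmod_pred_closed : zmod_closed quotmod_pred.
Proof.
split=> [|x y Sx Sy]; rewrite unfold_in; first exact: rpred0.
by rewrite -scaleN1r rpredD // rpredZ.
Qed.

HB.instance Definition _ :=
  GRing.isZmodClosed.Build M quotmod_pred quotmod_pred_closed.

Definition quotmod := Quotient.quot quotmod_pred.
HB.instance Definition _ := GRing.Zmodule.on quotmod.

Definition quotmod_pi : M -> quotmod := \pi_quotmod.
Definition quotmod_repr : quotmod -> M := repr.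

Lemma quotmod_piP x y : (quotmod_pi x = quotmod_pi y) <-> (x - y \in S).
Proof.
have -> : (x - y \in S) = (x - y \in quotmod_pred) by [].
by rewrite Quotient.idealrBE; split=> [/eqP|/eqP].
Qed.

Lemma quotmod_reprK : cancel quotmod_repr quotmod_pi.
Proof. exact: reprK. Qed.

Fact quotmod_pi_zmod : zmod_morphism quotmod_pi.
Proof. exact: (raddfB \pi_(Quotient.quot quotmod_pred)). Qed.

Definition quotmod_scale a (x : quotmod) := quotmod_pi (a *: quotmod_repr x).

Fact quotmod_pi_scale a x : quotmod_pi (a *: x) = quotmod_scale a (quotmod_pi x).
Proof.
apply/quotmod_piP; rewrite -scalerBr rpredZ //.
by apply/quotmod_piP; rewrite quotmod_reprK.
Qed.

Fact quotmod_piD x y : quotmod_pi (x + y) = quotmod_pi x + quotmod_pi y.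
Proof. exact: (raddfD \pi_(Quotient.quot quotmod_pred)). Qed.

Fact quotmod_scaleA a b x :
  quotmod_scale a (quotmod_scale b x) = quotmod_scale (a * b) x.
Proof. by rewrite -[x]quotmod_reprK -!quotmod_pi_scale scalerA. Qed.
Fact quotmod_scale1 : left_id 1 quotmod_scale.
Proof. by move=> x; rewrite -[x]quotmod_reprK -quotmod_pi_scale scale1r. Qed.
Fact quotmod_scaleDr : right_distributive quotmod_scale +%R.
Proof.
move=> a x y; rewrite -[x]quotmod_reprK -[y]quotmod_reprK.
by rewrite -quotmod_piD -!quotmod_pi_scale scalerDr quotmod_piD.
Qed.
Fact quotmod_scaleDl x : {morph quotmod_scale^~ x : a b / a + b}.
Proof.
move=> a b; rewrite -[x]quotmod_reprK.
by rewrite -!quotmod_pi_scale scalerDl quotmod_piD.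
Qed.

HB.instance Definition _ := GRing.Zmodule_isLmodule.Build k quotmod
  quotmod_scaleA quotmod_scale1 quotmod_scaleDr quotmod_scaleDl.

Fact quotmod_pi_linear : linear quotmod_pi.
Proof. by move=> a x y; rewrite quotmod_piD quotmod_pi_scale. Qed.

HB.instance Definition _ :=
  GRing.isLinear.Build k M quotmod *:%R quotmod_pi quotmod_pi_linear.

Section Lift.
Variables (N : lmodType k) (f : Lin M N).
Hypothesis f_S : forall x, x \in S -> f x = 0.

Definition quotmod_lift_fun (x : quotmod) : N := f (quotmod_repr x).

Lemma quotmod_lift_funE x : quotmod_lift_fun (quotmod_pi x) = f x.
Proof.
apply/eqP; rewrite -subr_eq0 -linearB; apply/eqP/f_S.
by apply/quotmod_piP; rewrite quotmod_reprK.
Qed.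

Fact quotmod_lift_linear : linear quotmod_lift_fun.
Proof.
move=> a x y; rewrite -[x]quotmod_reprK -[y]quotmod_reprK.
by rewrite -linearP !quotmod_lift_funE linearP.
Qed.

Definition quotmod_lift : Lin quotmod N := mkHom quotmod_lift_linear.

Lemma quotmod_liftE x : quotmod_lift (quotmod_pi x) = f x.
Proof. exact: quotmod_lift_funE. Qed.
End Lift.
End QuotientModule.

Section Span.
Variables (k : comPzRingType) (M : lmodType k) (A : set M).

Definition span : {pred M} := fun x =>
  `[< forall S : {pred M}, submod_closed S -> (forall y, A y -> y \in S) ->
      x \in S >].

Lemma spanP x : reflect (forall S : {pred M}, submod_closed S ->
  (forall y, A y -> y \in S) -> x \in S) (x \in span).
Proof. exact: asboolP. Qed.

Lemma span_gen x : A x -> x \in span.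
Proof. by move=> Ax; apply/spanP => S _; apply. Qed.

Fact span_submod_closed : submod_closed span.
Proof.
split=> [|a x y /spanP Sx /spanP Sy]; apply/spanP => S cS SA; first by case: cS.
by case: (cS) => _; apply; [exact: Sx | exact: Sy].
Qed.

HB.instance Definition _ := GRing.isSubmodClosed.Build k M span span_submod_closed.
End Span.

Section FreeModule.
Variables (k : comPzRingType) (T : choiceType).

Definition finsupp_pred : {pred T -> k^o} := fun f =>
  `[< exists s : seq T, forall x, x \notin s -> f x = 0 >].

Fact finsupp_submod_closed : submod_closed finsupp_pred.
Proof.
split=> [|a f g /asboolP[s fs] /asboolP[t gt]]; first by apply/asboolP; exists [::].
apply/asboolP; exists (s ++ t) => x; rewrite mem_cat negb_or => /andP[xs xt].
by rewrite !fctE /= fs // gt // scaler0 addr0.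
Qed.

HB.instance Definition _ :=
  GRing.isSubmodClosed.Build k (T -> k^o) finsupp_pred finsupp_submod_closed.

(* The free module on [T], as finitely supported functions. *)
Record freemod := FreeMod { coef :> T -> k^o; _ : coef \in finsupp_pred }.

HB.instance Definition _ := [isSub for coef].
HB.instance Definition _ := [Choice of freemod by <:].
HB.instance Definition _ := [SubChoice_isSubLmodule of freemod by <:].

Lemma freemod_ext (f g : freemod) : f =1 g -> f = g.
Proof. by move=> /funext fg; apply: val_inj. Qed.

Lemma coefP (a : k) (f g : freemod) x : (a *: f + g) x = a * f x + g x.
Proof. by rewrite -[LHS]/(val (a *: f + g) x) linearP. Qed.

Lemma freemod_suppP (f : freemod) :
  exists s : seq T, forall x, x \notin s -> f x = 0.
Proof. by case: f => f /= /asboolP. Qed.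

Definition freemod_supp (f : freemod) : seq T :=
  undup (projT1 (cid (freemod_suppP f))).

Lemma freemod_suppE f x : x \notin freemod_supp f -> f x = 0.
Proof. by rewrite mem_undup => /(projT2 (cid (freemod_suppP f))). Qed.

Fact freemod_gen_subproof (x : T) :
  (fun y => (y == x)%:R : k^o) \in finsupp_pred.
Proof. by apply/asboolP; exists [:: x] => y; rewrite inE => /negPf->. Qed.

Definition freemod_gen (x : T) : freemod := FreeMod (freemod_gen_subproof x).

Section Lift.
Variables (N : lmodType k) (g : T -> N).

Definition freemod_lift_fun (f : freemod) : N :=
  \sum_(x <- freemod_supp f) f x *: g x.

Lemma freemod_lift_funE (f : freemod) (s : seq T) :
    uniq s -> (forall x, x \notin s -> f x = 0) ->
  freemod_lift_fun f = \sum_(x <- s) f x *: g x.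
Proof.
have drop (u v : seq T) : (forall x, x \notin v -> f x = 0) ->
  \sum_(x <- u) f x *: g x = \sum_(x <- [seq x <- u | x \in v]) f x *: g x.
  move=> fv; rewrite big_filter [LHS](bigID (mem v)) /= [X in _ + X]big1 ?addr0 //.
  by move=> x /fv->; rewrite scale0r.
move=> us fs; rewrite /freemod_lift_fun (drop _ _ fs) [RHS](drop _ _ (@freemod_suppE f)).
apply: perm_big; apply: uniq_perm; rewrite ?filter_uniq ?undup_uniq //.
by move=> x; rewrite !mem_filter andbC.
Qed.

Fact freemod_lift_linear : linear freemod_lift_fun.
Proof.
move=> a f h; pose s := undup (freemod_supp f ++ freemod_supp h).
have us : uniq s by exact: undup_uniq.
have fs x : x \notin s -> f x = 0.
  by rewrite mem_undup mem_cat negb_or => /andP[/freemod_suppE].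
have hs x : x \notin s -> h x = 0.
  by rewrite mem_undup mem_cat negb_or => /andP[_ /freemod_suppE].
rewrite (freemod_lift_funE us fs) (freemod_lift_funE us hs).
rewrite (freemod_lift_funE us); last first.
  by move=> x xs; rewrite coefP fs // hs // mulr0 addr0.
rewrite scaler_sumr -big_split; apply: eq_bigr => x _.
by rewrite coefP scalerDl -scalerA.
Qed.

Definition freemod_lift : Lin freemod N := mkHom freemod_lift_linear.

Lemma freemod_liftE x : freemod_lift (freemod_gen x) = g x.
Proof.
rewrite /= (@freemod_lift_funE _ [:: x]) //= ?big_seq1 ?eqxx ?scale1r //.
by move=> y; rewrite inE => /negPf->.
Qed.
End Lift.

Lemma freemod_genE (f : freemod) :
  f = \sum_(x <- freemod_supp f) f x *: freemod_gen x.
Proof.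
apply: freemod_ext => y.
have ev_lin : linear (fun g : freemod => g y : k^o) by move=> a g h; exact: coefP.
rewrite -[RHS]/(mkHom ev_lin _) linear_sum.
have [yf|yf] := boolP (y \in freemod_supp f); last first.
  rewrite freemod_suppE // big1_seq // => x /andP[_ xf].
  have /negPf yx : y != x by apply: contraNneq yf => ->.
  by rewrite linearZ /= yx scaler0.
rewrite (bigD1_seq y) ?undup_uniq // big1_seq ?addr0; last first.
  by move=> x /andP[xy _]; rewrite linearZ /= eq_sym (negPf xy) scaler0.
by rewrite linearZ /= eqxx addr0 [_ *: _]mulr1.
Qed.

Lemma freemod_hom_ext (N : lmodType k) (f g : Lin freemod N) :
  (forall x, f (freemod_gen x) = g (freemod_gen x)) -> f = g.
Proof.
move=> fg; apply: hom_ext => x; rewrite (freemod_genE x) !linear_sum.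
by apply: eq_bigr => y _; rewrite !linearZ fg.
Qed.
End FreeModule.

Section Tensor.
Variables (k : comPzRingType) (U V : lmodType k).

Local Notation F := (freemod k (U * V)%type).
Local Notation gen := (freemod_gen k).

Inductive tensor_rel : F -> Prop :=
| TensorRelL a u u' v :
    tensor_rel (gen (a *: u + u', v) - (a *: gen (u, v) + gen (u', v)))
| TensorRelR a u v v' :
    tensor_rel (gen (u, a *: v + v') - (a *: gen (u, v) + gen (u, v'))).

Definition tensor : lmodType k := quotmod (span tensor_rel).

Definition tens (u : U) (v : V) : tensor := quotmod_pi _ (gen (u, v)).

Lemma tensPl a u u' v : tens (a *: u + u') v = a *: tens u v + tens u' v.
Proof.
rewrite /tens -linearP; apply/quotmod_piP.
by apply: span_gen; exact: TensorRelL.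
Qed.

Lemma tensPr a u v v' : tens u (a *: v + v') = a *: tens u v + tens u v'.
Proof.
rewrite /tens -linearP; apply/quotmod_piP.
by apply: span_gen; exact: TensorRelR.
Qed.

Section Lift.
Variables (W : lmodType k) (b : U -> V -> W).
Hypothesis b_bilinear : (forall v, linear (b^~ v)) /\ (forall u, linear (b u)).

Let lift0 : Lin F W := freemod_lift (fun p => b p.1 p.2).

Fact tensor_lift_subproof x : x \in span tensor_rel -> lift0 x = 0.
Proof.
case: b_bilinear => bl br.
move=> /spanP /(_ (fun y => lift0 y == 0))/(_ _ _)/eqP; apply.
  split=> [|a y z /eqP y0 /eqP z0]; rewrite unfold_in; first by rewrite linear0.
  by rewrite linearP y0 z0 scaler0 addr0.
move=> _ [a u u' v|a u v v']; rewrite unfold_in linearB linearP subr_eq0.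
  by rewrite !freemod_liftE /= bl.
by rewrite !freemod_liftE /= br.
Qed.

Fact tensor_lift_sig : {f : Lin tensor W | forall u v, f (tens u v) = b u v}.
Proof.
exists (quotmod_lift tensor_lift_subproof) => u v.
by rewrite /tens quotmod_liftE freemod_liftE.
Qed.

(* Opaque, since it is determined by [tensor_liftE] and [tensor_hom_ext]. *)
Definition tensor_lift : Lin tensor W := sval tensor_lift_sig.

Lemma tensor_liftE u v : tensor_lift (tens u v) = b u v.
Proof. exact: (svalP tensor_lift_sig). Qed.
End Lift.

Lemma tensor_hom_ext (W : lmodType k) (f g : Lin tensor W) :
  (forall u v, f (tens u v) = g (tens u v)) -> f = g.
Proof.
move=> fg; apply: hom_ext => x; rewrite -[x]quotmod_reprK.
have : f ∘ quotmod_pi _ = g ∘ quotmod_pi _ :> Lin F W.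
  by apply: freemod_hom_ext => -[u v]; exact: fg.
by move=> /(congr1 (fun h : Lin F W => h (quotmod_repr x))).
Qed.
End Tensor.

Arguments tensor_lift {k U V W} b b_bilinear.

Notation "U ⊗ V" := (tensor U%type V%type)
  (at level 40, left associativity) : type_scope.
Notation "u ⊗ v" := (tens u v)
  (at level 40, left associativity) : ring_scope.

Section TensorTheory.
Variables (k : comPzRingType) (U V : lmodType k).

Lemma tensDl (u u' : U) (v : V) : (u + u') ⊗ v = u ⊗ v + u' ⊗ v.
Proof. by have := tensPl 1 u u' v; rewrite !scale1r. Qed.
Lemma tensDr (u : U) (v v' : V) : u ⊗ (v + v') = u ⊗ v + u ⊗ v'.
Proof. by have := tensPr 1 u v v'; rewrite !scale1r. Qed.
Lemma tens0l (v : V) : (0 : U) ⊗ v = 0.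
Proof. by apply: (addrI ((0 : U) ⊗ v)); rewrite -tensDl !addr0. Qed.
Lemma tens0r (u : U) : u ⊗ (0 : V) = 0.
Proof. by apply: (addrI (u ⊗ (0 : V))); rewrite -tensDr !addr0. Qed.
Lemma tensZl a (u : U) (v : V) : (a *: u) ⊗ v = a *: (u ⊗ v).
Proof. by have := tensPl a u 0 v; rewrite tens0l !addr0. Qed.
Lemma tensZr a (u : U) (v : V) : u ⊗ (a *: v) = a *: (u ⊗ v).
Proof. by have := tensPr a u v 0; rewrite tens0r !addr0. Qed.
End TensorTheory.

Section TensorMap.
Variables (k : comPzRingType) (U U' V V' : lmodType k).
Variables (f : Lin U U') (g : Lin V V').

Fact tmap_bilinear :
  (forall v, linear (fun u => f u ⊗ g v)) /\ (forall u, linear (fun v => f u ⊗ g v)).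
Proof.
by split=> w a x y; rewrite linearP ?tensPl ?tensPr.
Qed.

Definition tmap : Lin (U ⊗ V) (U' ⊗ V') :=
  tensor_lift (fun u v => f u ⊗ g v) tmap_bilinear.

Lemma tmapE u v : tmap (u ⊗ v) = f u ⊗ g v.
Proof. exact: tensor_liftE. Qed.
End TensorMap.

Section TensorAssoc.
Variables (k : comPzRingType) (U V W : lmodType k).

Fact tassoc_bilinear1 (w : W) :
  (forall v : V, linear (fun u : U => u ⊗ (v ⊗ w))) /\
  (forall u : U, linear (fun v : V => u ⊗ (v ⊗ w))).
Proof. by split=> ? a x y; rewrite ?tensPl ?tensPr. Qed.

Let tassoc_fun (t : U ⊗ V) (w : W) : U ⊗ (V ⊗ W) :=
  tensor_lift (fun u v => u ⊗ (v ⊗ w)) (tassoc_bilinear1 w) t.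

Fact tassoc_bilinear :
  (forall w, linear (tassoc_fun^~ w)) /\ (forall t, linear (tassoc_fun t)).
Proof.
split=> [w|t a x y]; first exact: linearP.
rewrite /tassoc_fun -homZE -homDE; apply: hom_congr; apply: tensor_hom_ext => u v.
by rewrite !homE !tensor_liftE !tensPr.
Qed.

Definition tassoc : Lin ((U ⊗ V) ⊗ W) (U ⊗ (V ⊗ W)) :=
  tensor_lift tassoc_fun tassoc_bilinear.

Lemma tassocE u v w : tassoc ((u ⊗ v) ⊗ w) = u ⊗ (v ⊗ w).
Proof. by rewrite tensor_liftE /tassoc_fun tensor_liftE. Qed.

Fact tassocV_bilinear1 (u : U) :
  (forall w : W, linear (fun v : V => (u ⊗ v) ⊗ w)) /\
  (forall v : V, linear (fun w : W => (u ⊗ v) ⊗ w)).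
Proof. by split=> ? a x y; rewrite ?tensPr ?tensPl. Qed.

Let tassocV_fun (u : U) (t : V ⊗ W) : (U ⊗ V) ⊗ W :=
  tensor_lift (fun v w => (u ⊗ v) ⊗ w) (tassocV_bilinear1 u) t.

Fact tassocV_bilinear :
  (forall t, linear (tassocV_fun^~ t)) /\ (forall u, linear (tassocV_fun u)).
Proof.
split=> [t a x y|u]; last exact: linearP.
rewrite /tassocV_fun -homZE -homDE; apply: hom_congr; apply: tensor_hom_ext => v w.
by rewrite !homE !tensor_liftE !tensPl.
Qed.

Definition tassocV : Lin (U ⊗ (V ⊗ W)) ((U ⊗ V) ⊗ W) :=
  tensor_lift tassocV_fun tassocV_bilinear.

Lemma tassocVE u v w : tassocV (u ⊗ (v ⊗ w)) = (u ⊗ v) ⊗ w.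
Proof. by rewrite tensor_liftE /tassocV_fun tensor_liftE. Qed.
End TensorAssoc.

Section TensorAssocK.
Variables (k : comPzRingType) (U V W : lmodType k).

Lemma tensor3_hom_ext (X : lmodType k) (f g : Lin ((U ⊗ V) ⊗ W) X) :
  (forall u v w, f ((u ⊗ v) ⊗ w) = g ((u ⊗ v) ⊗ w)) -> f = g.
Proof.
move=> fg; apply: tensor_hom_ext => t w.
have lin (h : Lin ((U ⊗ V) ⊗ W) X) : linear (fun t => h (t ⊗ w)).
  by move=> a x y; rewrite tensPl linearP.
rewrite -[LHS]/(mkHom (lin f) t) -[RHS]/(mkHom (lin g) t); apply: hom_congr.
by apply: tensor_hom_ext => u v; exact: fg.
Qed.

Lemma tassocK : tassocV U V W ∘ tassoc U V W = hid.
Proof.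
by apply: tensor3_hom_ext => u v w; rewrite /= tassocE tassocVE.
Qed.

Lemma tassocVK : tassoc U V W ∘ tassocV U V W = hid.
Proof.
apply: tensor_hom_ext => u t.
have lin (h : Lin (U ⊗ (V ⊗ W)) (U ⊗ (V ⊗ W))) : linear (fun t => h (u ⊗ t)).
  by move=> a x y; rewrite tensPr linearP.
rewrite -[LHS]/(mkHom (lin (_ ∘ _)) t) -[RHS]/(mkHom (lin hid) t).
by apply: hom_congr; apply: tensor_hom_ext => v w; rewrite /= tassocVE tassocE.
Qed.
End TensorAssocK.

(* [V ⊗ V ⊗ V] is bracketed to the left: [tensid f] is [f ⊗ 1], and [1 ⊗ f] is
    [idtens f], or [idtens3 f] when its codomain is rebracketed to the left. *)

Section TripleTensor.
Variables (k : comPzRingType) (V : lmodType k).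

Definition tensid (W : lmodType k) (f : Lin (V ⊗ V) W) : Lin (V ⊗ V ⊗ V) (W ⊗ V) :=
  tmap f hid.

Definition idtens (W : lmodType k) (f : Lin (V ⊗ V) W) : Lin (V ⊗ V ⊗ V) (V ⊗ W) :=
  tmap hid f ∘ tassoc V V V.

Definition idtens3 (f : Lin (V ⊗ V) (V ⊗ V)) : Lin (V ⊗ V ⊗ V) (V ⊗ V ⊗ V) :=
  tassocV V V V ∘ idtens f.
End TripleTensor.

Definition invertible (k : comPzRingType) (U V : lmodType k) (f : Lin U V) :=
  exists g : Lin V U, g ∘ f = hid /\ f ∘ g = hid.

(* Algebras are associative, with no unit required. *)
Record is_braided_algebra (k : comPzRingType) (V : lmodType k)
    (mu : Lin (V ⊗ V) V) (R : Lin (V ⊗ V) (V ⊗ V)) : Prop := IsBraidedAlgebra {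
  braided_assoc : mu ∘ tensid mu = mu ∘ idtens mu;
  braided_invertible : invertible R;
  braided_YB :
    tensid R ∘ idtens3 R ∘ tensid R = idtens3 R ∘ tensid R ∘ idtens3 R;
  braided_YI : idtens mu ∘ tensid R ∘ idtens3 R = R ∘ tensid mu;
  braided_IY : tensid mu ∘ idtens3 R ∘ tensid R = R ∘ idtens mu
}.

Record is_braided_hom (k : comPzRingType) (V1 V2 : lmodType k)
    (mu1 : Lin (V1 ⊗ V1) V1) (R1 : Lin (V1 ⊗ V1) (V1 ⊗ V1))
    (mu2 : Lin (V2 ⊗ V2) V2) (R2 : Lin (V2 ⊗ V2) (V2 ⊗ V2))
    (f : Lin V1 V2) : Prop := IsBraidedHom {
  braided_hom_mul : f ∘ mu1 = mu2 ∘ tmap f f;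
  braided_hom_R : tmap f f ∘ R1 = R2 ∘ tmap f f
}.

(* The cohomology of L -f-> M -g-> N at M: the cocycles of [g] modulo those in
   the image of [f]. *)

Section Cohomology.
Variables (k : comPzRingType) (L M N : lmodType k) (f : Lin L M) (g : Lin M N).

Definition ker_pred : {pred M} := fun x => g x == 0.

Fact ker_submod_closed : submod_closed ker_pred.
Proof.
split=> [|a x y /eqP gx /eqP gy]; rewrite unfold_in ?linear0 //.
by rewrite linearP gx gy scaler0 addr0.
Qed.

HB.instance Definition _ := GRing.isSubmodClosed.Build k M ker_pred ker_submod_closed.

Record cocycle := Cocycle { cocycle_val :> M; _ : cocycle_val \in ker_pred }.

HB.instance Definition _ := [isSub for cocycle_val].
HB.instance Definition _ := [Choice of cocycle by <:].
HB.instance Definition _ := [SubChoice_isSubLmodule of cocycle by <:].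

Definition coboundary_pred : {pred cocycle} := fun z =>
  `[< exists x, f x = cocycle_val z >].

Fact coboundary_submod_closed : submod_closed coboundary_pred.
Proof.
split=> [|a x y /asboolP[u fu] /asboolP[v fv]]; apply/asboolP.
  by exists 0; rewrite linear0.
by exists (a *: u + v); rewrite linearP fu fv -[RHS]/(val _) linearP.
Qed.

HB.instance Definition _ :=
  GRing.isSubmodClosed.Build k cocycle coboundary_pred coboundary_submod_closed.

Definition cohomology : lmodType k := quotmod coboundary_pred.

Definition cohomology_class (z : cocycle) : cohomology := quotmod_pi _ z.
End Cohomology.

Section LinearFamilies.
Variables (k : comPzRingType) (A : lmodType k).

Lemma linear_fam_add (B : lmodType k) (F G : A -> B) :
  linear F -> linear G -> linear (fun x => F x + G x).
Proof. by move=> lF lG a x y; rewrite lF lG scalerDr addrACA. Qed.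

Lemma linear_fam_opp (B : lmodType k) (F : A -> B) :
  linear F -> linear (fun x => - F x).
Proof. by move=> lF a x y; rewrite lF opprD scalerN. Qed.

Lemma linear_fam_pair (B C : lmodType k) (F : A -> B) (G : A -> C) :
  linear F -> linear G -> linear (fun x => (F x, G x)).
Proof. by move=> lF lG a x y; rewrite lF lG. Qed.

Lemma linear_fam_hcompl (X Y Z : lmodType k) (F : A -> Lin Y Z) (g : Lin X Y) :
  linear F -> linear (fun x => F x ∘ g).
Proof. by move=> lF a x y; apply: hom_ext => z; rewrite lF. Qed.

Lemma linear_fam_hcompr (X Y Z : lmodType k) (F : A -> Lin X Y) (g : Lin Y Z) :
  linear F -> linear (fun x => g ∘ F x).
Proof. by move=> lF a x y; apply: hom_ext => z; rewrite lF /= linearP. Qed.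

Lemma linear_fam_tmapl (X X' Y Y' : lmodType k) (F : A -> Lin X X')
  (g : Lin Y Y') : linear F -> linear (fun x => tmap (F x) g).
Proof.
move=> lF a x y; apply: tensor_hom_ext => u v.
by rewrite lF !homE !tmapE !homE tensPl.
Qed.

Lemma linear_fam_tmapr (X X' Y Y' : lmodType k) (F : A -> Lin X X')
  (g : Lin Y Y') : linear F -> linear (fun x => tmap g (F x)).
Proof.
move=> lF a x y; apply: tensor_hom_ext => u v.
by rewrite lF !homE !tmapE !homE tensPr.
Qed.

Lemma linear_fam_fst (B C : lmodType k) (F : A -> (B * C)%type) :
  linear F -> linear (fun x => (F x).1).
Proof. by move=> lF a x y; rewrite lF. Qed.

Lemma linear_fam_snd (B C : lmodType k) (F : A -> (B * C)%type) :
  linear F -> linear (fun x => (F x).2).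
Proof. by move=> lF a x y; rewrite lF. Qed.

Lemma linear_fam_id : linear (fun x : A => x). Proof. by []. Qed.
End LinearFamilies.

Section YBH.
Variables (k : comPzRingType) (V : lmodType k).
Variables (mu : Lin (V ⊗ V) V) (R : Lin (V ⊗ V) (V ⊗ V)).

Definition C1_YBH : lmodType k := Lin V V.
Definition C2_YBH : lmodType k :=
  (Lin (V ⊗ V) (V ⊗ V) * Lin (V ⊗ V) V)%type.
Definition C3_YBH : lmodType k :=
  (Lin (V ⊗ V ⊗ V) (V ⊗ V ⊗ V) * Lin (V ⊗ V ⊗ V) (V ⊗ V) *
   Lin (V ⊗ V ⊗ V) (V ⊗ V) * Lin (V ⊗ V ⊗ V) V)%type.

Implicit Types (f : Lin V V) (phi : Lin (V ⊗ V) (V ⊗ V)) (psi : Lin (V ⊗ V) V).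

Definition delta1_YB f : Lin (V ⊗ V) (V ⊗ V) :=
  R ∘ tmap f hid + R ∘ tmap hid f - tmap f hid ∘ R - tmap hid f ∘ R.

Definition delta1_H f : Lin (V ⊗ V) V :=
  mu ∘ tmap f hid + mu ∘ tmap hid f - f ∘ mu.

Definition delta2_YB phi : Lin (V ⊗ V ⊗ V) (V ⊗ V ⊗ V) :=
  tensid R ∘ idtens3 R ∘ tensid phi + tensid R ∘ idtens3 phi ∘ tensid R
  + tensid phi ∘ idtens3 R ∘ tensid R - idtens3 R ∘ tensid R ∘ idtens3 phi
  - idtens3 R ∘ tensid phi ∘ idtens3 R - idtens3 phi ∘ tensid R ∘ idtens3 R.

Definition delta2_H psi : Lin (V ⊗ V ⊗ V) V :=
  mu ∘ tensid psi + psi ∘ tensid mu - mu ∘ idtens psi - psi ∘ idtens mu.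

Definition delta2_YI phi psi : Lin (V ⊗ V ⊗ V) (V ⊗ V) :=
  idtens psi ∘ tensid R ∘ idtens3 R + idtens mu ∘ tensid phi ∘ idtens3 R
  + idtens mu ∘ tensid R ∘ idtens3 phi - R ∘ tensid psi - phi ∘ tensid mu.

Definition delta2_IY phi psi : Lin (V ⊗ V ⊗ V) (V ⊗ V) :=
  tensid psi ∘ idtens3 R ∘ tensid R + tensid mu ∘ idtens3 phi ∘ tensid R
  + tensid mu ∘ idtens3 R ∘ tensid phi - R ∘ idtens psi - phi ∘ idtens mu.

Definition delta1_YBH_fun (f : C1_YBH) : C2_YBH := (delta1_YB f, delta1_H f).

Definition delta2_YBH_fun (c : C2_YBH) : C3_YBH :=
  (delta2_YB c.1, delta2_YI c.1 c.2, delta2_IY c.1 c.2, delta2_H c.2).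

Local Ltac linear_fam := lazymatch goal with |- GRing.linear_for _ ?H =>
  lazymatch H with
  | fun x => (@?F x, @?G x) => apply: (linear_fam_pair (F := F) (G := G)); linear_fam
  | fun x => @?F x + @?G x => apply: (linear_fam_add (F := F) (G := G)); linear_fam
  | fun x => - @?F x => apply: (linear_fam_opp (F := F)); linear_fam
  | fun x => @?F x ∘ @?G x => lazymatch G with
      | fun _ => ?g => apply: (linear_fam_hcompl g (F := F)); linear_fam
      | _ => lazymatch F with
        | fun _ => ?f => apply: (linear_fam_hcompr f (F := G)); linear_fam end end
  | fun x => tmap (@?F x) (@?G x) => lazymatch G with
      | fun _ => ?g => apply: (linear_fam_tmapl g (F := F)); linear_fam
      | _ => lazymatch F with
        | fun _ => ?f => apply: (linear_fam_tmapr f (F := G)); linear_fam end end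
  | fun x => (@?F x).1 => apply: (linear_fam_fst (F := F)); linear_fam
  | fun x => (@?F x).2 => apply: (linear_fam_snd (F := F)); linear_fam
  | fun x => x => exact: linear_fam_id
  end end.

Fact delta1_YBH_linear : linear delta1_YBH_fun.
Proof.
rewrite /C1_YBH /C2_YBH  /delta1_YBH_fun /delta1_YB /delta1_H; linear_fam.
Qed.

Fact delta2_YBH_linear : linear delta2_YBH_fun.
Proof.
rewrite /C2_YBH /C3_YBH /delta2_YBH_fun /delta2_YB /delta2_YI /delta2_IY /delta2_H.
rewrite /idtens3 /idtens /tensid; linear_fam.
Qed.

Definition delta1_YBH : Lin C1_YBH C2_YBH := mkHom delta1_YBH_linear.
Definition delta2_YBH : Lin C2_YBH C3_YBH := mkHom delta2_YBH_linear.

Definition Z2_YBH : Type := cocycle delta2_YBH.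
Definition H2_YBH : lmodType k := cohomology delta1_YBH delta2_YBH.
End YBH.


Section ComplexProperty.
Variables (k : comPzRingType).

Lemma hcompE (X Y Z : lmodType k) (f : Lin Y Z) (g : Lin X Y) x :
  (f ∘ g) x = f (g x).
Proof. by []. Qed.
Lemma hidE (X : lmodType k) (x : X) : (hid : Lin X X) x = x.
Proof. by []. Qed.
Lemma hcompA (X Y Z W : lmodType k) (f : Lin Z W) (g : Lin Y Z) (h : Lin X Y) :
  f ∘ (g ∘ h) = f ∘ g ∘ h.
Proof. exact: hom_ext. Qed.
Lemma hcompDl (X Y Z : lmodType k) (f g : Lin Y Z) (h : Lin X Y) :
  (f + g) ∘ h = f ∘ h + g ∘ h.
Proof. exact: hom_ext. Qed.
Lemma hcompBl (X Y Z : lmodType k) (f g : Lin Y Z) (h : Lin X Y) :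
  (f - g) ∘ h = f ∘ h - g ∘ h.
Proof. exact: hom_ext. Qed.
Lemma hcompDr (X Y Z : lmodType k) (h : Lin Y Z) (f g : Lin X Y) :
  h ∘ (f + g) = h ∘ f + h ∘ g.
Proof. by apply: hom_ext => x; rewrite /= linearD. Qed.
Lemma hcompBr (X Y Z : lmodType k) (h : Lin Y Z) (f g : Lin X Y) :
  h ∘ (f - g) = h ∘ f - h ∘ g.
Proof. by apply: hom_ext => x; rewrite /= linearB. Qed.
Lemma hcompid (X Y : lmodType k) (f : Lin X Y) : f ∘ hid = f.
Proof. exact: hom_ext. Qed.
Lemma hidcomp (X Y : lmodType k) (f : Lin X Y) : hid ∘ f = f.
Proof. exact: hom_ext. Qed.

Lemma tmap_comp (X X' X'' Y Y' Y'' : lmodType k) (f : Lin X' X'') (f' : Lin X X')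
    (g : Lin Y' Y'') (g' : Lin Y Y') :
  tmap (f ∘ f') (g ∘ g') = tmap f g ∘ tmap f' g'.
Proof. by apply: tensor_hom_ext => x y; rewrite /= !tmapE. Qed.
Lemma tmapDl (X X' Y Y' : lmodType k) (f f' : Lin X X') (g : Lin Y Y') :
  tmap (f + f') g = tmap f g + tmap f' g.
Proof. by apply: tensor_hom_ext => x y; rewrite !homE !tmapE tensDl. Qed.
Lemma tmapDr (X X' Y Y' : lmodType k) (f f' : Lin X X') (g : Lin Y Y') :
  tmap g (f + f') = tmap g f + tmap g f'.
Proof. by apply: tensor_hom_ext => x y; rewrite !homE !tmapE tensDr. Qed.
Lemma tmapNl (X X' Y Y' : lmodType k) (f : Lin X X') (g : Lin Y Y') :
  tmap (- f) g = - tmap f g.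
Proof. by apply/eqP; rewrite -addr_eq0 -tmapDl addNr; apply/eqP/tensor_hom_ext => x y;
  rewrite tmapE tens0l. Qed.
Lemma tmapNr (X X' Y Y' : lmodType k) (f : Lin X X') (g : Lin Y Y') :
  tmap g (- f) = - tmap g f.
Proof. by apply/eqP; rewrite -addr_eq0 -tmapDr addNr; apply/eqP/tensor_hom_ext => x y;
  rewrite tmapE tens0r. Qed.

Variables (V : lmodType k) (f : Lin V V).

Let D2 : Lin (V ⊗ V) (V ⊗ V) := tmap f hid + tmap hid f.
Let D3 : Lin (V ⊗ V ⊗ V) (V ⊗ V ⊗ V) := tmap D2 hid + tmap hid f.

Let tassoc_D3 : tassoc V V V ∘ D3 = (tmap f hid + tmap hid D2) ∘ tassoc V V V.
Proof.
apply: tensor3_hom_ext => u v w.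
rewrite !hcompE /D3 /D2 tassocE !homDE !tmapE !homDE !tmapE tensDl tensDr !linearD.
by rewrite !tassocE addrA.
Qed.

Let tassocV_D3 : tassocV V V V ∘ (tmap f hid + tmap hid D2) = D3 ∘ tassocV V V V.
Proof.
rewrite -[LHS]hcompid -(tassocVK V V V) hcompA -[_ ∘ _ ∘ tassoc _ _ _]hcompA -tassoc_D3.
by rewrite hcompA tassocK hidcomp.
Qed.

Let tensid_comm (W : lmodType k) (T : Lin (V ⊗ V) W) (E : Lin W W) :
  tensid (T ∘ D2 - E ∘ T) = tensid T ∘ D3 - (tmap E hid + tmap hid f) ∘ tensid T.
Proof.
rewrite /tensid tmapDl tmapNl /D3 hcompDr hcompDl -!tmap_comp !hcompid !hidcomp.
by rewrite opprD addrACA subrr addr0.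
Qed.

Let idtens_comm (W : lmodType k) (T : Lin (V ⊗ V) W) (E : Lin W W) :
  idtens (T ∘ D2 - E ∘ T) = idtens T ∘ D3 - (tmap f hid + tmap hid E) ∘ idtens T.
Proof.
rewrite /idtens -[_ ∘ tassoc _ _ _ ∘ D3]hcompA tassoc_D3 !hcompA -hcompBl.
congr (_ ∘ _); rewrite tmapDr tmapNr hcompDr hcompDl -!tmap_comp !hcompid !hidcomp.
by rewrite opprD addrACA subrr add0r.
Qed.

Let idtens3_comm (T : Lin (V ⊗ V) (V ⊗ V)) :
  idtens3 (T ∘ D2 - D2 ∘ T) = idtens3 T ∘ D3 - D3 ∘ idtens3 T.
Proof.
by rewrite /idtens3 idtens_comm hcompBr !hcompA tassocV_D3.
Qed.

Let tensid_comm3 (T : Lin (V ⊗ V) (V ⊗ V)) :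
  tensid (T ∘ D2 - D2 ∘ T) = tensid T ∘ D3 - D3 ∘ tensid T.
Proof. exact: tensid_comm. Qed.

Variables (mu : Lin (V ⊗ V) V) (R : Lin (V ⊗ V) (V ⊗ V)).
Hypothesis muRV : is_braided_algebra mu R.

Let delta1_YB_comm : delta1_YB R f = R ∘ D2 - D2 ∘ R.
Proof. by rewrite /delta1_YB /D2 hcompDr hcompDl opprD addrA. Qed.

Let delta1_H_comm : delta1_H mu f = mu ∘ D2 - f ∘ mu.
Proof. by rewrite /delta1_H /D2 hcompDr. Qed.

Lemma delta2_delta1_YBH : delta2_YBH mu R (delta1_YBH mu R f) = 0.
Proof.
have step (M : zmodType) (a b c : M) : a - b - (a - c) = c - b.
  by rewrite opprB addrC subrKA.
have step' (M : zmodType) (a b c : M) : a - b + (c - a) = c - b.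
  by rewrite addrC subrKA.
have [mulA _ YB YI IY] := muRV.
rewrite -[LHS]/(delta2_YBH_fun mu R (delta1_YB R f, delta1_H mu f)).
rewrite /delta2_YBH_fun /= delta1_YB_comm delta1_H_comm.
rewrite /delta2_YB /delta2_YI /delta2_IY /delta2_H.
rewrite !tensid_comm3 !idtens3_comm !tensid_comm !idtens_comm -/D2.
move: (tensid R) (idtens3 R) (tensid mu) (idtens mu) YB YI IY mulA.
move=> R12 R23 mu12 mu23 YB YI IY mulA; congr (_, _, _, _); rewrite !(hcompBr, hcompBl) !hcompA.
- have YB' := congr1 (fun h => D3 ∘ h) YB; rewrite !hcompA in YB'.
  by rewrite YB !subrKA !step YB' subrr.
- have YI' := congr1 (fun h => D2 ∘ h) YI; rewrite !hcompA in YI'.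
  by rewrite !step' YI !step YI' subrr.
- have IY' := congr1 (fun h => D2 ∘ h) IY; rewrite !hcompA in IY'.
  by rewrite !step' IY !step IY' subrr.
have mulA' := congr1 (fun h => f ∘ h) mulA; rewrite !hcompA in mulA'.
by rewrite subrKA mulA !step mulA' subrr.
Qed.
End ComplexProperty.

(* k[[ħ]]/(ħ^2), with [(a, b)] standing for a + ħ b. *)

Section DualNumbers.
Variable k : comPzRingType.

Definition dualnum_type : Type := (k * k)%type.
HB.instance Definition _ := GRing.Zmodule.copy dualnum_type (k * k)%type.

Implicit Types x y z : dualnum_type.

Definition dualnum_one : dualnum_type := (1, 0).
Definition dualnum_mul x y : dualnum_type := (x.1 * y.1, x.1 * y.2 + x.2 * y.1).

Fact dualnum_mulA : associative dualnum_mul.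
Proof.
by move=> x y z; congr pair; rewrite /= ?mulrDr ?mulrDl !mulrA ?addrA.
Qed.
Fact dualnum_mulC : commutative dualnum_mul.
Proof.
by move=> x y; congr pair; rewrite mulrC // addrC [y.1 * _]mulrC [y.2 * _]mulrC.
Qed.
Fact dualnum_mul1 : left_id dualnum_one dualnum_mul.
Proof. by case=> a b; rewrite /dualnum_mul /= !mul1r mul0r addr0. Qed.
Fact dualnum_mulDl : left_distributive dualnum_mul +%R.
Proof.
by move=> x y z; congr pair; rewrite /= !mulrDl // addrACA.
Qed.

HB.instance Definition _ := GRing.Zmodule_isComPzRing.Build dualnum_type
  dualnum_mulA dualnum_mulC dualnum_mul1 dualnum_mulDl.

Definition dualnum : comPzRingType := dualnum_type.

Definition hbar : dualnum := (0, 1) : dualnum_type.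
Definition dualnum_inj (a : k) : dualnum := (a, 0) : dualnum_type.

Lemma hbar_sq : hbar * hbar = 0.
Proof. by congr pair; rewrite /= ?mul0r ?mulr0 ?addr0. Qed.
End DualNumbers.
Arguments hbar {k}.

(* V ⊕ ħV, with [(v, w)] standing for v + ħ w. *)

Section DualModule.
Variables (k : comPzRingType) (V : lmodType k).

Definition dualmod_type : Type := (V * V)%type.
HB.instance Definition _ := GRing.Zmodule.copy dualmod_type (V * V)%type.

Definition dualmod_scale (c : dualnum k) (x : dualmod_type) : dualmod_type :=
  (c.1 *: x.1, c.1 *: x.2 + c.2 *: x.1).

Fact dualmod_scaleA a b x :
  dualmod_scale a (dualmod_scale b x) = dualmod_scale (a * b) x.
Proof.
by congr pair; rewrite /= ?scalerDr ?scalerDl !scalerA ?addrA.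
Qed.
Fact dualmod_scale1 : left_id 1 dualmod_scale.
Proof. by case=> v w; rewrite /dualmod_scale /= !scale1r scale0r addr0. Qed.
Fact dualmod_scaleDr : right_distributive dualmod_scale +%R.
Proof. by move=> a x y; congr pair; rewrite /= !scalerDr // addrACA. Qed.
Fact dualmod_scaleDl x : {morph dualmod_scale^~ x : a b / a + b}.
Proof. by move=> a b; congr pair; rewrite /= !scalerDl // addrACA. Qed.

HB.instance Definition _ := GRing.Zmodule_isLmodule.Build (dualnum k) dualmod_type
  dualmod_scaleA dualmod_scale1 dualmod_scaleDr dualmod_scaleDl.

Definition dualmod : lmodType (dualnum k) := dualmod_type.

Definition dualmod_pair (v w : V) : dualmod := (v, w) : dualmod_type.
End DualModule.

Arguments dualmod {k} V%_type.

Section DualHom.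
Variables (k : comPzRingType) (U V : lmodType k) (f : Lin U V).

Fact dualhom_linear :
  linear (fun x : dualmod U => dualmod_pair (f x.1) (f x.2)).
Proof. by move=> a x y; congr pair; rewrite /= !linearD !linearZ. Qed.

Definition dualhom : Lin (dualmod U) (dualmod V) := mkHom dualhom_linear.
End DualHom.

(* Restriction of scalars along k -> k[[ħ]]/(ħ^2). *)

Section Restriction.
Variables (k : comPzRingType) (N : lmodType (dualnum k)).

Definition restr_type : Type := N.
HB.instance Definition _ := GRing.Zmodule.on restr_type.

Definition restr_scale (a : k) (x : restr_type) : restr_type :=
  dualnum_inj a *: (x : N).

Fact restr_scaleA a b x : restr_scale a (restr_scale b x) = restr_scale (a * b) x.
Proof.
rewrite /restr_scale scalerA; congr (_ *: _).
by congr pair; rewrite /= mulr0 mul0r addr0.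
Qed.
Fact restr_scale1 : left_id 1 restr_scale.
Proof. by move=> x; exact: (scale1r (x : N)). Qed.
Fact restr_scaleDr : right_distributive restr_scale +%R.
Proof. by move=> a x y; exact: (scalerDr _ (x : N)). Qed.
Fact restr_scaleDl x : {morph restr_scale^~ x : a b / a + b}.
Proof.
move=> a b; rewrite /restr_scale -scalerDl; congr (_ *: _).
by congr pair; rewrite /= addr0.
Qed.

HB.instance Definition _ := GRing.Zmodule_isLmodule.Build k restr_type
  restr_scaleA restr_scale1 restr_scaleDr restr_scaleDl.

Definition restr : lmodType k := restr_type.
End Restriction.

Arguments restr {k} N%_type.

(* The isomorphism (U ⊕ ħU) ⊗ (V ⊕ ħV) ≅ (U ⊗ V) ⊕ ħ(U ⊗ V), where the tensor
    product on the left is over k[[ħ]]/(ħ^2). *)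

Section DualTensor.
Variables (k : comPzRingType) (U V : lmodType k).

Let dual_tensor_fun (x : dualmod U) (y : dualmod V) : dualmod (U ⊗ V) :=
  dualmod_pair (x.1 ⊗ y.1) (x.1 ⊗ y.2 + x.2 ⊗ y.1).

Fact dual_tensor_bilinear :
  (forall y, linear (dual_tensor_fun^~ y)) /\ (forall x, linear (dual_tensor_fun x)).
Proof.
split=> [y a x x'|x a y y']; congr pair; rewrite /= ?tensPl ?tensPr //.
  rewrite !tensDl !tensZl scalerDr.
  by rewrite (AC (2*(2*1)) (1*3*4*(2*5))).
rewrite !tensDr !tensZr scalerDr.
by rewrite (AC (3*2) (1*4*2*(3*5))).
Qed.

Definition dual_tensor : Lin (dualmod U ⊗ dualmod V) (dualmod (U ⊗ V)) :=
  tensor_lift dual_tensor_fun dual_tensor_bilinear.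

Lemma dual_tensorE x y : dual_tensor (x ⊗ y) =
  dualmod_pair (x.1 ⊗ y.1) (x.1 ⊗ y.2 + x.2 ⊗ y.1).
Proof. exact: tensor_liftE. Qed.

Let tens_inj_fun (u : U) (v : V) : restr (dualmod U ⊗ dualmod V) :=
  dualmod_pair u 0 ⊗ dualmod_pair v 0.

Fact tens_inj_bilinear :
  (forall v, linear (tens_inj_fun^~ v)) /\ (forall u, linear (tens_inj_fun u)).
Proof.
have pairP (W : lmodType k) a (w w' : W) : dualmod_pair (a *: w + w') 0 =
    dualnum_inj a *: dualmod_pair w 0 + dualmod_pair w' 0.
  by congr pair; rewrite /= scaler0 scale0r !addr0.
split=> [v a u u'|u a v v']; rewrite /tens_inj_fun pairP.
  exact: (tensPl (dualnum_inj a)).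
exact: (tensPr (dualnum_inj a)).
Qed.

Definition tens_inj : Lin (U ⊗ V) (restr (dualmod U ⊗ dualmod V)) :=
  tensor_lift tens_inj_fun tens_inj_bilinear.

Lemma tens_injE u v :
  tens_inj (u ⊗ v) = dualmod_pair u 0 ⊗ dualmod_pair v 0 :> dualmod U ⊗ dualmod V.
Proof. exact: (tensor_liftE tens_inj_bilinear u v). Qed.

Lemma tens_injZ a t : tens_inj (a *: t) =
  dualnum_inj a *: (tens_inj t : dualmod U ⊗ dualmod V).
Proof. exact: linearZ. Qed.

Let dual_tensorV_fun (t : dualmod (U ⊗ V)) : dualmod U ⊗ dualmod V :=
  (tens_inj t.1 : dualmod U ⊗ dualmod V) + hbar *: (tens_inj t.2 : dualmod U ⊗ dualmod V).

Fact dual_tensorV_linear : linear dual_tensorV_fun.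
Proof.
move=> c x y; rewrite /dual_tensorV_fun.
have injD t t' : tens_inj (t + t') = (tens_inj t : dualmod U ⊗ dualmod V) + tens_inj t'
  by exact: linearD.
rewrite /= !injD !tens_injZ.
have -> : c = dualnum_inj c.1 + hbar * dualnum_inj c.2.
  by case: c => a b; congr pair; rewrite /= ?mul0r ?mul1r ?mulr0 ?addr0 ?add0r.
rewrite !scalerDr !scalerDl !scalerA /=.
have -> : (hbar * dualnum_inj c.2) * hbar = 0.
  by rewrite mulrAC hbar_sq mul0r.
rewrite scale0r addr0 !(mul0r, mulr0, mul1r, addr0).
rewrite [dualnum_inj _ * hbar]mulrC.
by rewrite !add0r (AC (2*(2*1)) (1*4*3*(2*5))).
Qed.

Definition dual_tensorV : Lin (dualmod (U ⊗ V)) (dualmod U ⊗ dualmod V) :=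
  mkHom dual_tensorV_linear.

Lemma dualmodE (W : lmodType k) (x : dualmod W) :
  x = dualmod_pair x.1 0 + hbar *: dualmod_pair x.2 0.
Proof.
by case: x => v w; congr pair; rewrite /= ?scale0r ?scale1r ?scaler0 ?addr0 ?add0r.
Qed.

Lemma dual_tensorK : dual_tensorV ∘ dual_tensor = hid.
Proof.
apply: tensor_hom_ext => x y.
rewrite [LHS]/= dual_tensorE /dual_tensorV_fun [X in tens_inj X]/=.
rewrite [X in hbar *: tens_inj X]/=.
have injD t t' : tens_inj (t + t') = (tens_inj t : dualmod U ⊗ dualmod V) + tens_inj t'
  by exact: linearD.
rewrite injD !tens_injE /= [in RHS](dualmodE x) [in RHS](dualmodE y).
rewrite !tensDl !tensDr !tensZl !tensZr scalerA hbar_sq scale0r addr0 scalerDr.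
by rewrite addrA.
Qed.

Lemma dual_tensorVK : dual_tensor ∘ dual_tensorV = hid.
Proof.
have lin1 : linear (fun t => dual_tensor (tens_inj t) : restr (dualmod (U ⊗ V))).
  move=> a t t'; rewrite [tens_inj _]linearP.
  exact: (linearP dual_tensor (dualnum_inj a) (tens_inj t)).
have lin2 : linear (fun t : U ⊗ V => dualmod_pair t 0 : restr (dualmod (U ⊗ V))).
  by move=> a t t'; congr pair; rewrite /= scaler0 scale0r !addr0.
have injK t : dual_tensor (tens_inj t) = dualmod_pair t 0.
  have lin12 : mkHom lin1 = mkHom lin2.
    apply: tensor_hom_ext => u v; rewrite /= tens_injE dual_tensorE /=.
    by rewrite tens0l tens0r addr0.
  exact: (congr1 (fun h : Lin (U ⊗ V) (restr (dualmod (U ⊗ V))) => h t) lin12).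
apply: hom_ext => t; rewrite [RHS]/= [RHS](dualmodE t) [LHS]/= /dual_tensorV_fun.
by rewrite linearD linearZ /= !injK.
Qed.
End DualTensor.

Section Deformation.
Variables (k : comPzRingType) (V : lmodType k).

(* The ħ-linear extensions of maps on V ⊗ V, transported to the tensor square of
   V ⊕ ħV over k[[ħ]]/(ħ^2) along [dual_tensor]. *)
Definition ext_mul (f : Lin (V ⊗ V) V) : Lin (dualmod V ⊗ dualmod V) (dualmod V) :=
  dualhom f ∘ dual_tensor V V.

Definition ext_R (f : Lin (V ⊗ V) (V ⊗ V)) :
    Lin (dualmod V ⊗ dualmod V) (dualmod V ⊗ dualmod V) :=
  dual_tensorV V V ∘ dualhom f ∘ dual_tensor V V.

Definition in_hbar (M : lmodType (dualnum k)) (x : M) := exists y : M, x = hbar *: y.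

(* Candidate pairs (μ~, R~) on V ⊕ ħV. *)
Definition deformation_data : Type :=
  (Lin (dualmod V ⊗ dualmod V) (dualmod V) *
   Lin (dualmod V ⊗ dualmod V) (dualmod V ⊗ dualmod V))%type.

Implicit Type D : deformation_data.

Variables (mu : Lin (V ⊗ V) V) (R : Lin (V ⊗ V) (V ⊗ V)).

Record is_infinitesimal_deformation D : Prop := IsInfinitesimalDeformation {
  deformation_braided : is_braided_algebra D.1 D.2;
  deformation_mul : forall t, in_hbar (D.1 t - ext_mul mu t);
  deformation_R : forall t, in_hbar (D.2 t - ext_R R t)
}.

(* [c = (φ, ψ)] is sent to (μ + ħψ, R + ħφ). *)
Definition deform (c : C2_YBH V) : deformation_data :=
  (ext_mul mu + hbar *: ext_mul c.2, ext_R R + hbar *: ext_R c.1).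

Record is_deformation_hom D1 D2 (F : Lin (dualmod V) (dualmod V)) : Prop :=
    IsDeformationHom {
  deformation_hom_braided : is_braided_hom D1.1 D1.2 D2.1 D2.2 F;
  deformation_hom_id : forall v, in_hbar (F v - v)
}.

Definition isomorphic_deformations D1 D2 : Prop := exists F G,
  [/\ is_deformation_hom D1 D2 F, is_deformation_hom D2 D1 G,
      G ∘ F = hid & F ∘ G = hid].

Definition deformation_class D : set deformation_data :=
  [set D' | is_infinitesimal_deformation D' /\ isomorphic_deformations D D'].

Definition deformation_classes : set (set deformation_data) :=
  [set deformation_class D | D in is_infinitesimal_deformation].
End Deformation.

(* Main.v *)
Require Import Defs.
From mathcomp Require Import all_boot all_algebra.
From mathcomp Require Import boolp classical_sets functions.

(** Everything is a first-order Taylor expansion. Each map of k[ħ]/(ħ^2)-modules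
    between modules of the form U ⊕ ħU is a + ħb for unique k-linear a and b
    ([dual_map], [dual_map_surj], [dual_map_inj]), and two such maps compose by
    the Leibniz rule (a + ħb)(c + ħd) = ac + ħ(ad + bc) ([dual_map_comp]).

    The tensor square and cube of V ⊕ ħV over k[ħ]/(ħ^2) are not literally of
    this form, but become so along the isomorphisms [dual_tensor] and
    [dual_tensor3]. Along these, M = μ + ħψ and E = R + ħφ have
    M ⊗ 1 = (μ ⊗ 1) + ħ(ψ ⊗ 1), and likewise for 1 ⊗ M, E ⊗ 1 and 1 ⊗ E
    ([dual_tensid], [dual_idtens], [dual_tensid3], [dual_idtens3]). Hence each
    axiom of a braided algebra for (M, E) is an equality of two maps of the form
    a + ħb on V ⊗ V ⊗ V. Its degree 0 part is the same axiom for (μ, R), and its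
    degree 1 part says that the matching component of δ^2(φ, ψ) vanishes; the
    invertibility of E follows from that of R, as ħ is nilpotent. So (M, E) is a
    braided algebra exactly when (φ, ψ) is a cocycle ([dual_braidedP]).

    A map that is the identity modulo ħ is 1 + ħf, with tensor square
    1 + ħ(f ⊗ 1 + 1 ⊗ f). Comparing degree 1 parts once more, 1 + ħf is a
    homomorphism from the deformation given by c to that given by c' exactly when
    c - c' = δ^1(f) ([dual_braided_homP]), and it then has the inverse 1 - ħf.

    For the bijection with H^2, every deformation comes from a cocycle
    ([infinitesimal_deformE]), and the classes of two cocycles agree exactly when
    the cocycles are cohomologous ([deformation_class_eqP]). *)

Import GRing.Theory.
Local Open Scope ring_scope.
Local Open Scope classical_set_scope.

Set Implicit Arguments.
Unset Strict Implicit.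
Unset Printing Implicit Defensive.

(** * Linear maps over the dual numbers *)

Section DualMap.
Variable k : comPzRingType.
Implicit Types U V W : lmodType k.

Lemma hbarZE W (x : dualmod W) : hbar *: x = dualmod_pair 0 x.1.
Proof. by congr pair; rewrite /= ?scale0r ?scale1r ?add0r. Qed.

Lemma in_hbarE W (x : dualmod W) : in_hbar x <-> x.1 = 0.
Proof.
split=> [[y ->]|]; first by rewrite hbarZE.
by case: x => v w /= ->; exists (dualmod_pair w 0); rewrite hbarZE.
Qed.

Definition dual_map U V (a b : Lin U V) : Lin (dualmod U) (dualmod V) :=
  dualhom a + hbar *: dualhom b.

Lemma dual_mapE U V (a b : Lin U V) x :
  dual_map a b x = dualmod_pair (a x.1) (a x.2 + b x.1).
Proof. by rewrite homDE homZE hbarZE; congr pair; rewrite /= addr0. Qed.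

Lemma dual_map_comp U V W (a b : Lin V W) (c d : Lin U V) :
  dual_map a b ∘ dual_map c d = dual_map (a ∘ c) (a ∘ d + b ∘ c).
Proof.
apply: hom_ext => x; rewrite hcompE !dual_mapE /=.
by rewrite linearD addrA.
Qed.

Lemma dual_map_id V : dual_map hid 0 = hid :> Lin (dualmod V) (dualmod V).
Proof. by apply: hom_ext => -[v w]; rewrite dual_mapE /= addr0. Qed.

Lemma dual_map_inj U V (a b c d : Lin U V) :
  dual_map a b = dual_map c d -> a = c /\ b = d.
Proof.
move=> e; suff ev x : (a x, b x) = (c x, d x).
  by split; apply: hom_ext => x; case: (ev x).
have := hom_congr (dualmod_pair x 0) e.
by rewrite !dual_mapE /= !linear0 !add0r.
Qed.

(** As (v, w) is (v, 0) + ħ(w, 0), a k[ħ]/(ħ^2)-linear map is determined by its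
    values on the pairs (v, 0); a and b are the two components of that
    restriction. *)
Lemma dual_map_surj U V (F : Lin (dualmod U) (dualmod V)) :
  exists a b, F = dual_map a b.
Proof.
have pairP s (u u' : U) : dualmod_pair (s *: u + u') 0 =
    dualnum_inj s *: dualmod_pair u 0 + dualmod_pair u' 0.
  by congr pair; rewrite /= scaler0 scale0r !addr0.
have lin1 : linear (fun u : U => (F (dualmod_pair u 0)).1).
  by move=> s u u'; rewrite pairP linearP.
have lin2 : linear (fun u : U => (F (dualmod_pair u 0)).2).
  by move=> s u u'; rewrite pairP linearP /= scale0r addr0.
exists (mkHom lin1), (mkHom lin2); apply: hom_ext => x.
rewrite dual_mapE {1}(dualmodE x) linearD linearZ /= hbarZE.
by congr pair; rewrite /= ?addr0 // addrC.
Qed.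

(** As ħ^2 = 0, the geometric series for the inverse stops after two terms:
    (a + ħb)^-1 = a^-1 - ħ a^-1 b a^-1. *)
Lemma dual_map_invertible U V (a b : Lin U V) :
  invertible a -> invertible (dual_map a b).
Proof.
move=> [c [ca ac]]; exists (dual_map c (- (c ∘ b ∘ c))).
rewrite !dual_map_comp ca ac -!dual_map_id.
split; congr dual_map; apply: hom_ext => x; rewrite homDE /=.
  by rewrite -[c (a x)]hcompE ca subrr.
by rewrite linearN -[a (c _)]hcompE ac addNr.
Qed.
End DualMap.

(** * Tensor products over the dual numbers *)

Section DualTensorTheory.
Variable k : comPzRingType.
Implicit Types U V W : lmodType k.

(** The Leibniz rule for tensor products of maps:
    (a + ħb) ⊗ (c + ħd) = a ⊗ c + ħ(a ⊗ d + b ⊗ c). *)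
Lemma dual_tensor_tmap U U' V V' (a b : Lin U U') (c d : Lin V V') :
  dual_tensor U' V' ∘ tmap (dual_map a b) (dual_map c d) =
  dual_map (tmap a c) (tmap a d + tmap b c) ∘ dual_tensor U V.
Proof.
apply: tensor_hom_ext => x y.
rewrite !hcompE tmapE !dual_tensorE !dual_mapE /= linearD !tmapE.
by rewrite tensDl tensDr; congr pair; rewrite (AC (2*2) (1*3*(2*4))).
Qed.

(** The associator over the dual numbers is the ħ-linear extension of the one
    over k; this lets 1 ⊗ M, which is defined by rebracketing, be expanded. *)
Lemma dual_tensor_assoc U V W :
  dual_tensor U (V ⊗ W)%type ∘ tmap hid (dual_tensor V W) ∘
    tassoc (dualmod U) (dualmod V) (dualmod W) =
  dual_map (tassoc U V W) 0 ∘
    (dual_tensor (U ⊗ V)%type W ∘ tmap (dual_tensor U V) hid).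
Proof.
apply: tensor3_hom_ext => x y z.
rewrite !hcompE tassocE !tmapE !hidE !dual_tensorE dual_mapE.
rewrite hom0E addr0 /= linearD tensDr tensDl linearD !tassocE.
by rewrite addrA.
Qed.

Lemma dual_tensor_monic U V (X : lmodType (dualnum k))
    (f g : Lin X (dualmod U ⊗ dualmod V)) :
  dual_tensor U V ∘ f = dual_tensor U V ∘ g -> f = g.
Proof.
move=> /(congr1 (fun h => dual_tensorV U V ∘ h)).
by rewrite !hcompA dual_tensorK !hidcomp.
Qed.

Lemma dual_tensor_epic U V (X : lmodType (dualnum k))
    (f g : Lin (dualmod (U ⊗ V)) X) :
  f ∘ dual_tensor U V = g ∘ dual_tensor U V -> f = g.
Proof.
move=> /(congr1 (fun h => h ∘ dual_tensorV U V)).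
by rewrite -!hcompA dual_tensorVK !hcompid.
Qed.
End DualTensorTheory.

Section DualTriple.
Variables (k : comPzRingType) (V : lmodType k).

Local Notation T2 := (dual_tensor V V).

Definition dual_tensor3 :
    Lin (dualmod V ⊗ dualmod V ⊗ dualmod V) (dualmod (V ⊗ V ⊗ V)) :=
  dual_tensor (V ⊗ V)%type V ∘ tmap T2 hid.

Local Notation T3 := dual_tensor3.

(** Half of [dual_tensor3] is invertible by functoriality; together with the
    inverse of [dual_tensor] this makes [dual_tensor3] cancellable on both sides. *)
Lemma tmap_dual_tensorK (X : lmodType (dualnum k)) :
  tmap (dual_tensorV V V) hid ∘ tmap T2 (@hid _ X) = hid /\
  tmap T2 (@hid _ X) ∘ tmap (dual_tensorV V V) hid = hid.
Proof.
rewrite -!tmap_comp dual_tensorK dual_tensorVK hidcomp.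
by split; apply: tensor_hom_ext => x y; rewrite tmapE.
Qed.

Lemma dual_tensor3_epic (X : lmodType (dualnum k))
    (f g : Lin (dualmod (V ⊗ V ⊗ V)) X) : f ∘ T3 = g ∘ T3 -> f = g.
Proof.
rewrite /T3 !hcompA => /(congr1 (fun h => h ∘ tmap (dual_tensorV V V) hid)).
rewrite -!hcompA (tmap_dual_tensorK _).2 !hcompid; exact: dual_tensor_epic.
Qed.

Lemma dual_tensor3_monic (X : lmodType (dualnum k))
    (f g : Lin X (dualmod V ⊗ dualmod V ⊗ dualmod V)) :
  T3 ∘ f = T3 ∘ g -> f = g.
Proof.
rewrite /T3 -!hcompA => /dual_tensor_monic.
move=> /(congr1 (fun h => tmap (dual_tensorV V V) hid ∘ h)).
by rewrite !hcompA (tmap_dual_tensorK _).1 !hidcomp.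
Qed.

(** The legs of a + ħb on the triple tensor product have no cross terms, since the
    identity factor has no ħ part. *)
Section Legs.
Variables (W : lmodType k) (a b : Lin (V ⊗ V) W).

Lemma dual_tensid :
  dual_tensor W V ∘ tensid (dual_map a b ∘ T2) =
  dual_map (tensid a) (tensid b) ∘ T3.
Proof.
rewrite /tensid -[hid in LHS]hidcomp tmap_comp hcompA -{1}dual_map_id.
rewrite dual_tensor_tmap -hcompA; congr (dual_map _ _ ∘ _).
by apply: tensor_hom_ext => x y; rewrite homDE !tmapE tens0r add0r.
Qed.

Lemma dual_idtens :
  dual_tensor V W ∘ idtens (dual_map a b ∘ T2) =
  dual_map (idtens a) (idtens b) ∘ T3.
Proof.
have -> : idtens (dual_map a b ∘ T2) =
    tmap (dual_map hid 0) (dual_map a b) ∘ tmap hid T2 ∘ tassoc _ _ _.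
  by rewrite -tmap_comp dual_map_id hidcomp.
rewrite !hcompA dual_tensor_tmap -!hcompA (hcompA (dual_tensor V (V ⊗ V)%type)).
rewrite dual_tensor_assoc hcompA dual_map_comp.
congr (dual_map _ _ ∘ _).
apply: hom_ext => t; rewrite homDE !hcompE homDE hom0E linear0 add0r.
have -> : tmap (0 : Lin V V) a = 0.
  by apply: tensor_hom_ext => x y; rewrite tmapE tens0l.
by rewrite addr0.
Qed.
End Legs.

Section TripleLegs.
Variables a b : Lin (V ⊗ V) (V ⊗ V).
Variable E : Lin (dualmod V ⊗ dualmod V) (dualmod V ⊗ dualmod V).
Hypothesis T2E : T2 ∘ E = dual_map a b ∘ T2.

Lemma dual_tensid3 : T3 ∘ tensid E = dual_map (tensid a) (tensid b) ∘ T3.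
Proof.
rewrite -dual_tensid -T2E /T3 -hcompA; congr (_ ∘ _).
by rewrite /tensid -tmap_comp hidcomp.
Qed.

(** The rebracketing of the codomain has no ħ part, being the inverse of an
    associator that has none. *)
Lemma dual_idtens3 : T3 ∘ idtens3 E = dual_map (idtens3 a) (idtens3 b) ∘ T3.
Proof.
have assocV : T3 ∘ tassocV _ _ _ =
    dual_map (tassocV V V V) 0 ∘ (dual_tensor V (V ⊗ V)%type ∘ tmap hid T2).
  rewrite -[in RHS](hcompid (tmap hid T2)) -(tassocVK _ _ _).
  rewrite !hcompA -!(hcompA (dual_map _ _)) dual_tensor_assoc.
  rewrite 2!hcompA dual_map_comp tassocK !hcompA; congr (_ ∘ _ ∘ _).
  rewrite -[dual_tensor (V ⊗ V)%type V in LHS]hidcomp -dual_map_id.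
  by congr (dual_map _ _ ∘ _); apply: hom_ext => t; rewrite homDE /= linear0 addr0.
rewrite {1}/idtens3 hcompA assocV -!hcompA.
have -> : tmap hid T2 ∘ idtens E = idtens (dual_map a b ∘ T2).
  by rewrite -T2E /idtens hcompA -tmap_comp hidcomp.
rewrite dual_idtens hcompA dual_map_comp; congr (dual_map _ _ ∘ _).
by apply: hom_ext => t; rewrite homDE !hcompE hom0E addr0.
Qed.
End TripleLegs.
End DualTriple.

(** * Braided structures on V ⊕ ħV *)

(** The Leibniz rule for maps that are of the form a + ħb only along given
    identifications [P], [Q], [S]. Iterating it expands both sides of each axiom
    for the deformed structure. *)
Lemma dual_map_chain (k : comPzRingType) (U V W : lmodType k)
    (X Y Z : lmodType (dualnum k)) (P : Lin X (dualmod U)) (Q : Lin Y (dualmod V))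
    (S : Lin Z (dualmod W)) (F : Lin Y Z) (G : Lin X Y)
    (a b : Lin V W) (c d : Lin U V) :
  S ∘ F = dual_map a b ∘ Q -> Q ∘ G = dual_map c d ∘ P ->
  S ∘ (F ∘ G) = dual_map (a ∘ c) (a ∘ d + b ∘ c) ∘ P.
Proof.
move=> SF QG.
by rewrite hcompA SF -hcompA QG hcompA dual_map_comp.
Qed.

(** Once the degree 0 parts agree, only the degree 1 parts remain to be compared;
    the difference is the form in which the coboundaries are written. *)
Lemma dual_map_eqP (k : comPzRingType) (U V : lmodType k) (a a' b b' : Lin U V) :
  a = a' -> (dual_map a b = dual_map a' b') <-> (b - b' = 0).
Proof.
move=> <-; split=> [/dual_map_inj[_ ->]|/eqP]; first by rewrite subrr.
by rewrite subr_eq0 => /eqP->.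
Qed.

Section DeformedStructures.
Variables (k : comPzRingType) (V : lmodType k).
Variables (mu psi psi' : Lin (V ⊗ V) V) (R phi phi' : Lin (V ⊗ V) (V ⊗ V)).
Variables (M M' : Lin (dualmod V ⊗ dualmod V) (dualmod V)).
Variables (E E' : Lin (dualmod V ⊗ dualmod V) (dualmod V ⊗ dualmod V)).

Local Notation T2 := (dual_tensor V V).
Local Notation T3 := (dual_tensor3 V).

Hypothesis ME : M = dual_map mu psi ∘ T2.
Hypothesis M'E : M' = dual_map mu psi' ∘ T2.
Hypothesis T2E : T2 ∘ E = dual_map R phi ∘ T2.
Hypothesis T2E' : T2 ∘ E' = dual_map R phi' ∘ T2.

(** In this lemma and the next three, the Leibniz rule on the two sides of an axiom
    yields one term for each position at which the ħ part can be placed, and these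
    are the terms of the corresponding coboundary. *)
Lemma dual_assocP : mu ∘ tensid mu = mu ∘ idtens mu ->
  M ∘ tensid M = M ∘ idtens M <-> delta2_H mu psi = 0.
Proof.
move=> mulA.
have T1M : hid ∘ M = dual_map mu psi ∘ T2 by rewrite hidcomp.
(* M takes values in V ⊕ ħV itself, so its identification [S] is the identity. *)
have l := dual_map_chain T1M (dual_tensid mu psi).
have r := dual_map_chain T1M (dual_idtens mu psi).
rewrite -ME !hidcomp in l r; rewrite l r.
split=> [/dual_tensor3_epic/(dual_map_eqP _ _ mulA) <-|d0].
  by rewrite /delta2_H opprD !addrA.
congr (_ ∘ _); apply/(dual_map_eqP _ _ mulA); rewrite -[RHS]d0.
by rewrite /delta2_H opprD !addrA.
Qed.

Lemma dual_YBP :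
  tensid R ∘ idtens3 R ∘ tensid R = idtens3 R ∘ tensid R ∘ idtens3 R ->
  tensid E ∘ idtens3 E ∘ tensid E = idtens3 E ∘ tensid E ∘ idtens3 E <->
  delta2_YB R phi = 0.
Proof.
move=> YB; have [t i] := (dual_tensid3 T2E, dual_idtens3 T2E).
have l := dual_map_chain (dual_map_chain t i) t.
have r := dual_map_chain (dual_map_chain i t) i.
have dE : tensid R ∘ idtens3 R ∘ tensid phi +
   (tensid R ∘ idtens3 phi + tensid phi ∘ idtens3 R) ∘ tensid R -
   (idtens3 R ∘ tensid R ∘ idtens3 phi +
   (idtens3 R ∘ tensid phi + idtens3 phi ∘ tensid R) ∘ idtens3 R) =
   delta2_YB R phi.
  by rewrite /delta2_YB !hcompDl !opprD !addrA.
split=> [e|d0].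
  rewrite e r in l; move/dual_tensor3_epic: l => /esym/(dual_map_eqP _ _ YB) <-.
  by rewrite dE.
apply: dual_tensor3_monic; rewrite l r; congr (_ ∘ _).
by apply/(dual_map_eqP _ _ YB); rewrite dE.
Qed.

Lemma dual_YIP : idtens mu ∘ tensid R ∘ idtens3 R = R ∘ tensid mu ->
  idtens M ∘ tensid E ∘ idtens3 E = E ∘ tensid M <-> delta2_YI mu R phi psi = 0.
Proof.
move=> YI; have [t i] := (dual_tensid3 T2E, dual_idtens3 T2E).
have [tM iM] := (dual_tensid mu psi, dual_idtens mu psi).
rewrite -ME in tM iM.
have l := dual_map_chain (dual_map_chain iM t) i.
have r := dual_map_chain T2E tM.
have dE : idtens mu ∘ tensid R ∘ idtens3 phi +
   (idtens mu ∘ tensid phi + idtens psi ∘ tensid R) ∘ idtens3 R -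
   (R ∘ tensid psi + phi ∘ tensid mu) = delta2_YI mu R phi psi.
  rewrite /delta2_YI !hcompDl !opprD !addrA; congr (_ - _ - _).
  by rewrite (ACl (3*2*1)).
split=> [e|d0].
  rewrite e r in l; move/dual_tensor3_epic: l => /esym/(dual_map_eqP _ _ YI) <-.
  by rewrite dE.
apply: dual_tensor_monic; rewrite l r; congr (_ ∘ _).
by apply/(dual_map_eqP _ _ YI); rewrite dE.
Qed.

Lemma dual_IYP : tensid mu ∘ idtens3 R ∘ tensid R = R ∘ idtens mu ->
  tensid M ∘ idtens3 E ∘ tensid E = E ∘ idtens M <-> delta2_IY mu R phi psi = 0.
Proof.
move=> IY; have [t i] := (dual_tensid3 T2E, dual_idtens3 T2E).
have [tM iM] := (dual_tensid mu psi, dual_idtens mu psi).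
rewrite -ME in tM iM.
have l := dual_map_chain (dual_map_chain tM i) t.
have r := dual_map_chain T2E iM.
have dE : tensid mu ∘ idtens3 R ∘ tensid phi +
   (tensid mu ∘ idtens3 phi + tensid psi ∘ idtens3 R) ∘ tensid R -
   (R ∘ idtens psi + phi ∘ idtens mu) = delta2_IY mu R phi psi.
  rewrite /delta2_IY !hcompDl !opprD !addrA; congr (_ - _ - _).
  by rewrite (ACl (3*2*1)).
split=> [e|d0].
  rewrite e r in l; move/dual_tensor3_epic: l => /esym/(dual_map_eqP _ _ IY) <-.
  by rewrite dE.
apply: dual_tensor_monic; rewrite l r; congr (_ ∘ _).
by apply/(dual_map_eqP _ _ IY); rewrite dE.
Qed.

Lemma dual_R_invertible : invertible R -> invertible E.
Proof.
move=> /(dual_map_invertible phi)[G [GR RG]].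
have EE : E = dual_tensorV V V ∘ (dual_map R phi ∘ T2).
  by rewrite -T2E hcompA dual_tensorK hidcomp.
exists (dual_tensorV V V ∘ (G ∘ T2)); rewrite EE; split.
  rewrite -!hcompA (hcompA T2) dual_tensorVK hidcomp (hcompA G) GR hidcomp.
  exact: dual_tensorK.
rewrite -!hcompA (hcompA T2) dual_tensorVK hidcomp (hcompA (dual_map _ _)) RG.
rewrite hidcomp; exact: dual_tensorK.
Qed.

Lemma dual_braidedP : is_braided_algebra mu R ->
  is_braided_algebra M E <-> delta2_YBH mu R (phi, psi) = 0.
Proof.
case=> mulA Rinv YB YI IY; rewrite -[delta2_YBH mu R _]/(_, _, _, _).
split=> [[/(dual_assocP mulA) d1 _ /(dual_YBP YB) d2 /(dual_YIP YI) d3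
  /(dual_IYP IY) d4]|d0]; first by congr (_, _, _, _).
have d1 : delta2_H mu psi = 0 := congr1 (fun c => c.2) d0.
have d2 : delta2_YB R phi = 0 := congr1 (fun c => c.1.1.1) d0.
have d3 : delta2_YI mu R phi psi = 0 := congr1 (fun c => c.1.1.2) d0.
have d4 : delta2_IY mu R phi psi = 0 := congr1 (fun c => c.1.2) d0.
split; [exact/(dual_assocP mulA)|exact: dual_R_invertible|exact/(dual_YBP YB)|
  exact/(dual_YIP YI)|exact/(dual_IYP IY)].
Qed.

(** In degree 1, M' (F ⊗ F) = F M reads ψ' + μ(f ⊗ 1 + 1 ⊗ f) = ψ + fμ for
    F = 1 + ħf, that is ψ - ψ' = δ^1_H(f); with R in place of μ the map f acts on
    V ⊗ V as the derivation f ⊗ 1 + 1 ⊗ f, which gives a commutator with R. *)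
Lemma dual_braided_homP f :
  is_braided_hom M E M' E' (dual_map hid f) <->
  (phi, psi) - (phi', psi') = delta1_YBH mu R f.
Proof.
rewrite -[(phi, psi) - _]/(phi - phi', psi - psi') -[delta1_YBH _ _ _]/(_, _).
have T1F : hid ∘ dual_map hid f = dual_map hid f ∘ hid by rewrite hidcomp hcompid.
have T1M : hid ∘ M = dual_map mu psi ∘ T2 by rewrite hidcomp.
have T1M' : hid ∘ M' = dual_map mu psi' ∘ T2 by rewrite hidcomp.
have FF := dual_tensor_tmap hid f hid f.
have tid : tmap hid hid = @hid _ (V ⊗ V)%type.
  by apply: tensor_hom_ext => u v; rewrite tmapE.
rewrite tid addrC in FF.
have lM := dual_map_chain T1F T1M; have rM := dual_map_chain T1M' FF.
have lE := dual_map_chain FF T2E; have rE := dual_map_chain T2E' FF.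
have zE (A : zmodType) (x y z t : A) : x - y = z - t <-> x + t - (z + y) = 0.
  have -> : x + t - (z + y) = x - y - (z - t).
    by rewrite opprB opprD (AC (2*2) ((1*4)*(2*3))).
  split=> [->|/eqP]; first by rewrite subrr.
  by rewrite subr_eq0 => /eqP.
pose D := tmap f hid + tmap hid f.
have dM : delta1_H mu f = mu ∘ D - f ∘ mu.
  by rewrite /delta1_H -hcompDr.
have dE : delta1_YB R f = R ∘ D - D ∘ R.
  by rewrite /delta1_YB -hcompDr -addrA -opprD -hcompDl.
rewrite dM dE; move: lM rM lE rE; rewrite -/D !(hidcomp, hcompid) => lM rM lE rE.
split=> [[eM eE]|e].
  congr (_, _); apply/zE.
    rewrite eE rE in lE; move/dual_tensor_epic: lE => /esym/dual_map_eqP.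
    exact.
  rewrite eM rM in lM; move/dual_tensor_epic: lM => /esym/dual_map_eqP.
  exact.
have /zE eE := congr1 (fun c => c.1) e; have /zE eM := congr1 (fun c => c.2) e.
split; first by rewrite lM rM; congr (_ ∘ _); exact/dual_map_eqP.
apply: dual_tensor_monic; rewrite lE rE; congr (_ ∘ _).
exact/dual_map_eqP.
Qed.
End DeformedStructures.

(** * Deformations and cohomology classes *)

Section DeformationData.
Variables (k : comPzRingType) (V : lmodType k).
Variables (mu : Lin (V ⊗ V) V) (R : Lin (V ⊗ V) (V ⊗ V)).
Implicit Types (c : C2_YBH V) (D : deformation_data V).

Local Notation T2 := (dual_tensor V V).

Lemma dual_tensorVKE x : T2 (dual_tensorV V V x) = x.
Proof. by rewrite -[LHS]hcompE dual_tensorVK. Qed.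

Lemma deform_mulE c : (deform mu R c).1 = dual_map mu c.2 ∘ T2.
Proof. exact: hom_ext. Qed.

Lemma deform_RE c : T2 ∘ (deform mu R c).2 = dual_map R c.1 ∘ T2.
Proof.
apply: hom_ext => t; rewrite /deform hcompE homDE homZE linearD linearZ.
by rewrite ![ext_R _ _]/= !(dual_tensorVKE (dualhom _ _)).
Qed.

(** Membership in ħ(V ⊗ V) can be tested after the identification with
    (V ⊗ V) ⊕ ħ(V ⊗ V), as the inverse identification is ħ-linear too. *)
Lemma dual_tensor_hbarP (t : dualmod V ⊗ dualmod V) :
  in_hbar t <-> (T2 t).1 = 0.
Proof.
rewrite -in_hbarE; split=> [[y ->]|[y ty]].
  by exists (T2 y); rewrite linearZ.
exists (dual_tensorV V V y).
by rewrite -[t]hidE -dual_tensorK hcompE ty linearZ.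
Qed.

Lemma deform_infinitesimalP c : is_braided_algebra mu R ->
  is_infinitesimal_deformation mu R (deform mu R c) <-> delta2_YBH mu R c = 0.
Proof.
move=> muR; have bP := dual_braidedP (deform_mulE c) (deform_RE c) muR.
rewrite {2}[c]surjective_pairing -bP; split=> [[]//|bD]; split=> // t.
  by rewrite /deform /= addrC addKr; exists (ext_mul c.2 t).
by rewrite /deform /= addrC addKr; exists (ext_R c.1 t).
Qed.

(** Both structure maps have an expansion a + ħb, and being congruent to μ and R
    modulo ħ pins down the degree 0 parts. *)
Lemma infinitesimal_deformE D : is_infinitesimal_deformation mu R D ->
  exists c, D = deform mu R c.
Proof.
case=> _ Dmu DR.
have [a [psi ea]] := dual_map_surj (D.1 ∘ dual_tensorV V V).
have [r [phi er]] := dual_map_surj (T2 ∘ D.2 ∘ dual_tensorV V V).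
have D1E : D.1 = dual_map a psi ∘ T2.
  by rewrite -ea -hcompA dual_tensorK hcompid.
have D2E : T2 ∘ D.2 = dual_map r phi ∘ T2.
  by rewrite -er -hcompA dual_tensorK hcompid.
have aE : a = mu.
  apply: hom_ext => t; apply/eqP; rewrite -subr_eq0; apply/eqP.
  have /in_hbarE := Dmu (dual_tensorV V V (dualmod_pair t 0)).
  by rewrite D1E !hcompE dual_tensorVKE dual_mapE.
have rE : r = R.
  apply: hom_ext => t; apply/eqP; rewrite -subr_eq0; apply/eqP.
  have /dual_tensor_hbarP := DR (dual_tensorV V V (dualmod_pair t 0)).
  by rewrite linearB -[T2 (D.2 _)]hcompE D2E !hcompE !dual_tensorVKE dual_mapE.
exists (phi, psi); rewrite [LHS]surjective_pairing [RHS]surjective_pairing.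
congr (_, _); first by rewrite deform_mulE D1E aE.
by apply: dual_tensor_monic; rewrite deform_RE D2E rE.
Qed.

Lemma deformation_homP c c' F :
  is_deformation_hom (deform mu R c) (deform mu R c') F <->
  exists2 f : C1_YBH V, F = dual_map hid f & c - c' = delta1_YBH mu R f.
Proof.
have bP f := dual_braided_homP (deform_mulE c) (deform_mulE c')
  (deform_RE c) (deform_RE c') f.
rewrite -!surjective_pairing in bP.
split=> [[bF idF]|[f -> cc]].
  have [a [f FE]] := dual_map_surj F.
  have aE : a = hid.
    apply: hom_ext => v; apply/eqP; rewrite -subr_eq0; apply/eqP.
    by have /in_hbarE := idF (dualmod_pair v 0); rewrite FE dual_mapE.
  by rewrite FE aE in bF *; exists f => //; apply/bP.
split; first exact/bP.
by move=> v; apply/in_hbarE; rewrite dual_mapE /= subrr.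
Qed.

(** A single homomorphism already gives an isomorphism: 1 - ħf is the inverse of
    1 + ħf, and it is a homomorphism because δ^1 is additive. *)
Lemma isomorphic_deformationsP c c' :
  isomorphic_deformations (deform mu R c) (deform mu R c') <->
  exists f : C1_YBH V, c - c' = delta1_YBH mu R f.
Proof.
split=> [[F [_ [/deformation_homP[f _ cc] _ _ _]]]|[f cc]]; first by exists f.
exists (dual_map hid f), (dual_map hid (- f)); split.
- by apply/deformation_homP; exists f.
- by apply/deformation_homP; exists (- f); rewrite // linearN -cc opprB.
- by rewrite dual_map_comp !(hidcomp, hcompid) subrr dual_map_id.
by rewrite dual_map_comp !(hidcomp, hcompid) addNr dual_map_id.
Qed.

Hypothesis muR : is_braided_algebra mu R.

(** That isomorphism is an equivalence relation on deformations is read off from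
    the coboundaries being a subgroup. *)
Lemma deformation_class_eqP c c' : delta2_YBH mu R c' = 0 ->
  deformation_class mu R (deform mu R c) =
    deformation_class mu R (deform mu R c') <->
  exists f : C1_YBH V, c - c' = delta1_YBH mu R f.
Proof.
move=> c'0; split=> [e|[f cc]].
  have : deformation_class mu R (deform mu R c') (deform mu R c').
    split; first exact/deform_infinitesimalP.
    by apply/isomorphic_deformationsP; exists 0; rewrite linear0 subrr.
  by rewrite -e => -[_ /isomorphic_deformationsP].
have sub c1 c2 g : c1 - c2 = delta1_YBH mu R g ->
    deformation_class mu R (deform mu R c1) `<=`
    deformation_class mu R (deform mu R c2).
  move=> c12 D [Dinf isoD]; split=> //; move: isoD.
  have [d ->] := infinitesimal_deformE Dinf => /isomorphic_deformationsP[h c1d].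
  apply/isomorphic_deformationsP; exists (h - g).
  by rewrite linearB -c12 -c1d opprB [RHS]addrC subrKA.
apply/seteqP; split; first exact: (sub _ _ f).
by apply: (sub _ _ (- f)); rewrite linearN -cc opprB.
Qed.

Lemma deformation_classes_H2 :
  exists F : H2_YBH mu R -> set (deformation_data V),
    (forall z : Z2_YBH mu R,
       F (cohomology_class (delta1_YBH mu R) z) =
       deformation_class mu R (deform mu R (cocycle_val z))) /\
    set_bij [set: H2_YBH mu R] (deformation_classes mu R) F.
Proof.
have cocycle0 (z : Z2_YBH mu R) : delta2_YBH mu R (cocycle_val z) = 0.
  by case: z => c /= /eqP.
have cohomologousP (z z' : Z2_YBH mu R) :
    cohomology_class (delta1_YBH mu R) z = cohomology_class (delta1_YBH mu R) z' <->
    exists f : C1_YBH V, cocycle_val z - cocycle_val z' = delta1_YBH mu R f.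
  have valB : cocycle_val (z - z') = cocycle_val z - cocycle_val z'.
    exact: (raddfB val).
  rewrite quotmod_piP -valB; split=> [/asboolP[f <-]|[f zz]]; first by exists f.
  by apply/asboolP; exists f.
(* Any choice of representative cocycles gives the same map, by [FE]. *)
pose F (h : H2_YBH mu R) :=
  deformation_class mu R (deform mu R (cocycle_val (quotmod_repr h))).
have FE z : F (cohomology_class (delta1_YBH mu R) z) =
    deformation_class mu R (deform mu R (cocycle_val z)).
  apply/deformation_class_eqP; first exact: cocycle0.
  by apply/cohomologousP; rewrite /cohomology_class quotmod_reprK.
have repr_class (h : H2_YBH mu R) :
    h = cohomology_class (delta1_YBH mu R) (quotmod_repr h).
  by rewrite /cohomology_class quotmod_reprK.
exists F; split=> //; split.
- move=> h _; exists (deform mu R (cocycle_val (quotmod_repr h))) => //.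
  exact/deform_infinitesimalP.
- move=> h h' _ _; rewrite (repr_class h) (repr_class h') !FE.
  by move/deformation_class_eqP => /(_ (cocycle0 _))/cohomologousP.
move=> _ [D Dinf <-]; have [c DE] := infinitesimal_deformE Dinf.
have c0 : delta2_YBH mu R c = 0 by apply/deform_infinitesimalP; rewrite -?DE.
have cz : c \in ker_pred (delta2_YBH mu R) by exact/eqP.
by exists (cohomology_class (delta1_YBH mu R) (Cocycle cz)); rewrite // FE DE.
Qed.
End DeformationData.

Theorem theorem3p9 (k : comPzRingType) (V : lmodType k)
    (mu : Lin (V ⊗ V) V) (R : Lin (V ⊗ V) (V ⊗ V))
    (braided : is_braided_algebra mu R) :
  [/\ (forall c : C2_YBH V, delta2_YBH mu R c = 0 ->
         is_infinitesimal_deformation mu R (deform mu R c)),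
      (forall D : deformation_data V, is_infinitesimal_deformation mu R D ->
         exists c : C2_YBH V, delta2_YBH mu R c = 0 /\ D = deform mu R c),
      (forall c c' : C2_YBH V, delta2_YBH mu R c = 0 -> delta2_YBH mu R c' = 0 ->
         isomorphic_deformations (deform mu R c) (deform mu R c') <->
         exists f : C1_YBH V, c - c' = delta1_YBH mu R f) &
      exists F : H2_YBH mu R -> set (deformation_data V),
        (forall z : Z2_YBH mu R,
           F (cohomology_class (delta1_YBH mu R) z) =
           deformation_class mu R (deform mu R (cocycle_val z))) /\
        set_bij [set: H2_YBH mu R] (deformation_classes mu R) F].
Proof.
split=> [c /deform_infinitesimalP|D Dinf|c c' _ _|]; first exact.
- have [c DE] := infinitesimal_deformE Dinf; exists c; split=> //.
  by apply/deform_infinitesimalP; rewrite -?DE.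
- exact: isomorphic_deformationsP.
exact: deformation_classes_H2.
Qed.
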